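(* Let $X$ be a hereditarily locally connected continuum. Then $X$ has the $\omega$-FTP property if and only if $X$ is completely regular.
   Context: A continuum is a compact connected metric space; it is degenerate if it has only one point. $X$ is hereditarily locally connected if every subcontinuum of $X$ is locally connected, and completely regular if every non-degenerate subcontinuum of $X$ has non-empty interior in $X$. For continuous $f:X\to X$ and $x\in X$, $\omega_f(x)=\{y\in X:\ \exists\, n_i\to+\infty,\ f^{n_i}(x)\to y\}$; it is totally periodic if every point of it is periodic for $f$. A compact metric space $X$ has the $\omega$-FTP property if for every continuous $f:X\to X$, every totally periodic $\omega$-limit set of $f$ is finite. *)

(* Defs.v *)
From mathcomp Require Import all_boot all_order all_algebra.
From mathcomp Require Import all_classical all_reals all_analysis.
Set Implicit Arguments. Unset Strict Implicit. Unset Printing Implicit Defensive.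
Import Order.TTheory GRing.Theory Num.Theory.
Local Open Scope classical_set_scope.

Section Defs.
Context {R : realType} {T : pseudoMetricType R}.

Definition continuum_set (A : set T) : Prop :=
  A !=set0 /\ compact A /\ connected A.

Definition nondegenerate (A : set T) : Prop :=
  exists x y, A x /\ A y /\ x <> y.

(* A is locally connected (in its subspace topology): every point of A has a
   base of connected relatively-open neighbourhoods in A. Relatively open sets
   of A are the sets O `&` A with O open in T. *)
Definition locally_connected_set (A : set T) : Prop :=
  forall x, A x -> forall U, nbhs x U ->
    exists O : set T, [/\ open O, O x, O `&` A `<=` U & connected (O `&` A)].

Definition is_continuum : Prop :=
  hausdorff_space T /\ continuum_set [set: T].

Definition hereditarily_locally_connected : Prop :=
  forall A, continuum_set A -> locally_connected_set A.

Definition completely_regular_continuum : Prop :=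
  forall A, continuum_set A -> nondegenerate A -> (A°) !=set0.

Definition omega_limit (f : T -> T) (x : T) : set T :=
  [set y | exists s : nat -> nat,
     (forall N, \forall i \near \oo, (N <= s i)%N) /\
     (fun i => iter (s i) f x) @ \oo --> y].

Definition periodic_point (f : T -> T) (y : T) : Prop :=
  exists n, (0 < n)%N /\ iter n f y = y.

Definition totally_periodic (f : T -> T) (A : set T) : Prop :=
  forall y, A y -> periodic_point f y.

Definition omega_FTP : Prop :=
  forall f : T -> T, continuous f ->
    forall x, totally_periodic f (omega_limit f x) -> finite_set (omega_limit f x).

End Defs.

(* Main.v *)
Require Import Defs.
From mathcomp Require Import all_boot all_order all_algebra.
From mathcomp Require Import all_classical all_reals all_analysis.
From mathcomp Require Import zify ring lra.

Set Implicit Arguments.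
Unset Strict Implicit.
Unset Printing Implicit Defensive.

Import Order.TTheory GRing.Theory Num.Theory.
Import numFieldNormedType.Exports.
Local Open Scope classical_set_scope.
Local Open Scope ring_scope.

(** Sufficiency. Let W be an infinite totally periodic omega-limit set. If W has
    interior, the orbit enters W, so it is eventually periodic and W is finite.
    Otherwise complete regularity makes every subcontinuum of W a point, so W has
    a base of relatively clopen sets. By a Baire argument some power of f is the
    identity on a nonempty relatively clopen set; pulling back a small such set
    along the powers of f gives a proper nonempty invariant relatively clopen
    subset of W, which no omega-limit set admits.

    Necessity. Let A be a nondegenerate subcontinuum with empty interior. An
    irreducible subcontinuum M of A between two points is locally connected by
    hypothesis, and this makes it an arc: order M by the intersections S(x) of all
    subcontinua containing a and x, and use the sum over k of 2^-k dist(q_k, S(x)),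
    with (q_k) dense, as a coordinate. Extend the coordinate to Phi on the whole
    space by Tietze. Since M is nowhere dense, there are points x_n outside M and
    short paths J_n from gamma(t_n) in M to x_n, where the parameters t_n sweep
    [0, 1] back and forth with steps tending to 0. Perturbing the retraction
    gamma o Phi onto M in disjoint shrinking regions around the x_n, so that x_n
    travels along M and then up J_(n+1), gives a continuous f that fixes M
    pointwise and sends x_n to x_(n+1); the omega-limit set of x_0 is then an
    infinite set of fixed points. *)

(** * Intersections of filtered families of compact sets *)

Section FilteredIntersections.
Context {R : realType} {T : pseudoMetricType R}.
Hypothesis hT : hausdorff_space T.
Variable F : set (set T).
Hypothesis F0 : F !=set0.
Hypothesis Fcompact : forall A, F A -> compact A.
Hypothesis Fdir : forall A B, F A -> F B -> exists2 C, F C & C `<=` A `&` B.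

(** If no member were inside [O], the sets [A \ O] would generate a proper filter. Its cluster point
    in one compact member lies in every closed set [A \ O], hence in the intersection but not in
    [O]. *)
Lemma filtered_bigcap_subset_open (O : set T) :
  open O -> \bigcap_(A in F) A `<=` O -> exists2 A, F A & A `<=` O.
Proof.
move=> oO FO; apply: contrapT => nF.
have ne A : F A -> A `\` O !=set0.
  move=> FA; apply: contrapT => /set0P/negP; rewrite negbK => /eqP AO.
  apply: nF; exists A => // x Ax; apply: contrapT => Ox.
  by have : (A `\` O) x by []; rewrite AO.
pose G := filter_from F (fun A => A `\` O).
have GF : ProperFilter G.
  apply: filter_from_proper => //; apply: filter_from_filter => // A B FA FB.
  have [C FC CAB] := Fdir FA FB; exists C => // x [Cx Ox].
  by have [Ax Bx] := CAB _ Cx.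
have [A0 FA0] := F0.
have [|p [A0p clp]] := Fcompact FA0 (F := G); first by exists A0 => // x [].
have pcl A : F A -> (A `\` O) p.
  move=> FA; suff : closure (A `\` O) p.
    rewrite -(iffLR (closure_id _))//.
    rewrite setDE; apply: closedI; last exact: open_closedC.
    exact: compact_closed (Fcompact FA).
  by move=> B nB; apply: clp => //; exists A.
have [_ nOp] := pcl _ FA0.
by apply: nOp; apply: FO => A FA; have [] := pcl _ FA.
Qed.

(** Two separated pieces of the intersection are closed, so normality puts them in disjoint open
    sets, whose union already contains some member. By hypothesis a further member lies on one side,
    which empties the other piece. The hypothesis is phrased so as to cover both chains of continua
    and families of relatively clopen sets. *)
Lemma filtered_bigcap_connected :
  (forall A U V, F A -> open U -> open V -> U `&` V = set0 -> A `<=` U `|` V ->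
     (exists2 B, F B & B `<=` U) \/ (exists2 B, F B & B `<=` V)) ->
  connected (\bigcap_(A in F) A).
Proof.
move=> FUV; apply/connectedP => E [E0 EU [Ecl1 Ecl2]].
set I := \bigcap_(A in F) A in EU.
have clI : closed I by apply: closed_bigI => A FA; exact: compact_closed (Fcompact FA).
have Esub b : E b `<=` I by rewrite EU => x Ex; case: b Ex; [right|left].
have Ecl b : closed (E b).
  move=> x clx; have Ix : I x.
    by rewrite (iffLR (closure_id _) clI); exact: closureS (@Esub b) _ clx.
  move: (Ix); rewrite EU => -[|]; case: b clx => clx // Ex.
    by have : (E false `&` closure (E true)) x by []; rewrite Ecl2.
  by have : (closure (E false) `&` E true) x by []; rewrite Ecl1.
have Edisj : E false `&` E true = set0.
  by apply/seteqP; split=> // x [/subset_closure H1 H2]; rewrite -Ecl1.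
have /(@normal_openP R) nT := @pseudometric_normal R T.
have [U [V [oU oV EU' EV' UV]]] := nT _ _ (Ecl false) (Ecl true) Edisj.
have [] := @filtered_bigcap_subset_open (U `|` V) (openU oU oV).
  by rewrite -/I EU => x [/EU'|/EV']; [left|right].
have disj x : U x -> V x -> False by move=> Ux Vx; have : (U `&` V) x by []; rewrite UV.
move=> A FA AUV; have [[B FB BU]|[B FB BV]] := FUV _ _ _ FA oU oV UV AUV.
  have [x Ex] := E0 true; apply: (disj x); last exact: EV'.
  by apply: BU; exact: Esub Ex _ FB.
have [x Ex] := E0 false; apply: (disj x); first exact: EU'.
by apply: BV; exact: Esub Ex _ FB.
Qed.
End FilteredIntersections.

(** * Irreducible subcontinua *)

Section Continua.
Context {R : realType} {T : pseudoMetricType R}.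
Hypothesis hT : hausdorff_space T.

Lemma chain_bigcap_continuum (F : set (set T)) :
  F !=set0 -> (forall A, F A -> continuum_set A) ->
  (forall A B, F A -> F B -> A `<=` B \/ B `<=` A) ->
  continuum_set (\bigcap_(A in F) A).
Proof.
move=> F0 Fcont Fch.
have Fc A : F A -> compact A by move=> /Fcont[_ []].
have Fdir A B : F A -> F B -> exists2 C, F C & C `<=` A `&` B.
  by move=> FA FB; have [AB|BA] := Fch _ _ FA FB; [exists A|exists B] => // x;
     split=> //; [exact: AB|exact: BA].
have [A0 FA0] := F0.
split.
  apply: contrapT => /set0P/negP; rewrite negbK => /eqP I0.
  have [|A FA] := filtered_bigcap_subset_open hT F0 Fc Fdir (@open0 T).
    by rewrite I0.
  by have [[x Ax] _] := Fcont _ FA => /(_ _ Ax).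
split.
  apply: (subclosed_compact _ (Fc _ FA0)); last by move=> x; exact.
  by apply: closed_bigI => A FA; exact: compact_closed (Fc _ FA).
apply: filtered_bigcap_connected => // A U V FA oU oV UV AUV.
have sep : separated U V.
  split; apply/seteqP; split=> // x [].
    by move=> clU Vx; have [y []] := clU _ (open_nbhs_nbhs (conj oV Vx));
       move=> Uy Vy; have : (U `&` V) y by []; rewrite UV.
  by move=> Ux clV; have [y []] := clV _ (open_nbhs_nbhs (conj oU Ux));
       move=> Vy Uy; have : (U `&` V) y by []; rewrite UV.
have [_ [_ cA]] := Fcont _ FA.
by have [AU|AV] := connected_subset sep AUV cA; [left|right]; exists A.
Qed.

Lemma irreducible_subcontinuum (A : set T) (a b : T) :
  continuum_set A -> A a -> A b ->
  exists M, [/\ continuum_set M, M `<=` A, M a, M b &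
    forall D, continuum_set D -> D `<=` M -> D a -> D b -> D = M].
Proof.
move=> cA Aa Ab.
(* [Zorn_bigcup] yields maximal sets, so it is applied to the removed part [B]: a maximal [B] leaves
   a minimal continuum. *)
pose P (B : set T) := [/\ continuum_set (A `\` B), B `<=` A, ~ B a & ~ B b].
have [|B [[cB BA Ba Bb] Bmax]] := @Zorn_bigcup T P.
  move=> F FP Ftot; have [->|/set0P F0] := eqVneq F set0.
    by rewrite bigcup_set0; split => //; rewrite setD0.
  split; [|by move=> x [X FX]; have [_ + _ _] := FP _ FX; exact|by case=> X /FP[]..].
  have -> : A `\` \bigcup_(X in F) X = \bigcap_(D in [set A `\` X | X in F]) D.
    apply/seteqP; split=> x.
      by move=> [Ax nx] _ [X FX <-]; split=> // Xx; apply: nx; exists X.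
    move=> H; have [X0 FX0] := F0; split.
      by have [] := H _ (imageP _ FX0).
    by move=> [X FX Xx]; have [_] := H _ (imageP _ FX); exact.
  apply: chain_bigcap_continuum.
  - by have [X0 FX0] := F0; exists (A `\` X0); exact: imageP.
  - by move=> _ [X FX <-]; have [] := FP _ FX.
  - by move=> _ _ [X FX <-] [Y FY <-]; have [XY|YX] := Ftot _ _ FX FY;
      [right|left]; apply: setDS.
exists (A `\` B); split => //.
move=> D cD DM Da Db; apply/seteqP; split=> // x [Ax Bx].
apply: contrapT => Dx; apply: (Bmax (A `\` D)).
  split=> [y By|H]; first by split; [exact: BA|move=> /DM[]].
  by apply: Bx; apply: H.
split; [|by move=> y []|by move=> []..].
by rewrite setDD setIidr// => y /DM[].
Qed.

End Continua.

(** * Distances and weighted sums *)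

Lemma invS_lt {R : realType} (e : R) : 0 < e ->
  exists N, forall n, (N <= n)%N -> n.+1%:R^-1 < e.
Proof.
move=> e0; have [N ne] : exists N, N.+1%:R^-1 < e.
  exact: filter_ex (near_infty_natSinv_lt (PosNum e0)).
by exists N => n Nn; apply: le_lt_trans ne; rewrite lef_pV2 ?posrE// ler_nat.
Qed.

Section SetDistance.
Context {R : realType} {T : pseudoMetricType R}.
Implicit Types (x y q : T) (A B : set T) (e : R).

(* Capped at 1, since possibly no ball around x meets A. *)
Definition setdist x A : R :=
  inf [set e | e = 1 \/ 0 < e /\ exists2 a, A a & ball x e a].

Let E x A := [set e | e = 1 \/ 0 < e /\ exists2 a, A a & ball x e a].

Let E0 x A : E x A !=set0. Proof. by exists 1; left. Qed.

Let Elb x A : lbound (E x A) 0.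
Proof. by move=> e [->|[/ltW]]. Qed.

Let Ehlb x A : has_lbound (E x A). Proof. by exists 0; exact: Elb. Qed.

Lemma setdist_ge0 x A : 0 <= setdist x A.
Proof. exact: lb_le_inf (E0 x A) (@Elb x A). Qed.

Lemma setdist_le1 x A : setdist x A <= 1.
Proof. by apply: (ge_inf (Ehlb x A)); left. Qed.

Lemma setdist_le x A a e : 0 < e -> A a -> ball x e a -> setdist x A <= e.
Proof. by move=> e0 Aa xa; apply: (ge_inf (Ehlb x A)); right; split=> //; exists a. Qed.

Lemma le_setdist x A c : c <= 1 ->
  (forall e a, 0 < e -> A a -> ball x e a -> c <= e) -> c <= setdist x A.
Proof.
move=> c1 H; apply: lb_le_inf (E0 x A) _ => e [->//|[e0 [a Aa xa]]].
exact: H Aa xa.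
Qed.

Lemma setdistS x A B : A `<=` B -> setdist x B <= setdist x A.
Proof.
move=> AB; apply: le_setdist (setdist_le1 _ _) _ => e a e0 Aa xa.
exact: setdist_le e0 (AB _ Aa) xa.
Qed.

Lemma setdist_approx x A B d : 0 < d ->
  (forall a, A a -> exists2 b, B b & ball a d b) ->
  setdist x B <= setdist x A + d.
Proof.
move=> d0 H; rewrite -lerBlDr; apply: le_setdist.
  by rewrite lerBlDr (le_trans (setdist_le1 _ _))// lerDl ltW.
move=> e a e0 /H[b Bb ab] xa; rewrite lerBlDr.
by apply: (@setdist_le _ _ b) => //; [exact: addr_gt0|exact: ball_triangle xa ab].
Qed.

Lemma setdist_lip x y A d : 0 < d -> ball x d y -> setdist x A <= setdist y A + d.
Proof.
move=> d0 xy; rewrite -lerBlDr; apply: le_setdist.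
  by rewrite lerBlDr (le_trans (setdist_le1 _ _))// lerDl ltW.
move=> e a e0 Aa ya; rewrite lerBlDr addrC.
by apply: (@setdist_le _ _ a) => //; [exact: addr_gt0|exact: ball_triangle xy ya].
Qed.

Lemma setdist_continuous A : continuous (setdist ^~ A : T -> R).
Proof.
move=> x; apply/cvgrPdist_le => e e0; near=> y.
have xy : ball x e y by near: y; exact: nbhsx_ballx.
by rewrite ler_distlC; have := setdist_lip A e0 xy;
  have := setdist_lip A e0 (ball_sym xy); lra.
Unshelve. all: end_near. Qed.

Lemma setdist0 x A : A x -> setdist x A = 0.
Proof.
move=> Ax; apply/eqP; rewrite eq_le setdist_ge0 andbT.
apply/ler_addgt0Pl => e e0; rewrite addr0.
exact: setdist_le e0 Ax (ballxx _ e0).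
Qed.

Lemma setdist_gt0 x A : closed A -> ~ A x -> 0 < setdist x A.
Proof.
move=> cA nAx; have /nbhs_ballP[e /= e0 eA] : nbhs x (~` A).
  by apply: open_nbhs_nbhs; split=> //; exact: closed_openC.
have m0 : 0 < Num.min e 1 by rewrite lt_min e0 ltr01.
apply: lt_le_trans m0 _; apply: le_setdist; first by rewrite ge_min lexx orbT.
move=> e' a e'0 Aa xa; rewrite ge_min; apply/orP; left; rewrite leNgt; apply/negP => e'e.
by apply: (eA a) => //; exact: le_ball (ltW e'e) _ xa.
Qed.

Lemma compact_dense_sequence : compact [set: T] -> T ->
  exists q : nat -> T, forall x e, 0 < e -> exists k, ball (q k) e x.
Proof.
move=> cT x0.
have net n : exists s : seq T, forall x, exists2 y, y \in s & ball y (n.+1%:R^-1) x.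
  have n0 : 0 < n.+1%:R^-1 :> R by rewrite invr_gt0 ltr0n.
  (* Finite sequences filtered by inclusion: the near-covering form of compactness then turns the
     local centres into one finite net. *)
  pose F := filter_from [set: seq T] (fun s => [set s' : seq T | {subset s <= s'}]).
  have FF : ProperFilter F.
    apply: filter_from_proper => [|s _]; last by exists s => y.
    apply: filter_from_filter; first by exists [::].
    move=> s s' _ _; exists (s ++ s') => // t st; split=> y ys; apply: st;
      by rewrite mem_cat ys ?orbT.
  have [|s Hs] := filter_ex
    (iffLR (compact_near_coveringP _) cT _ F (fun s x => exists2 y, y \in s & ball y n.+1%:R^-1 x) _ _).
    move=> x _; exists (ball x n.+1%:R^-1, [set s : seq T | x \in s]) => /=.
      split; first exact: nbhsx_ballx.
      by exists [:: x] => // s; apply; rewrite inE.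
    by move=> [y s] /= [xy xs]; exists x.
  by exists s => x; exact: Hs.
pose s n := sval (cid (net n)).
(* The nets of all radii form a double array, enumerated through [unpickle]; [x0] fills the
   positions outside it. *)
pose q k := if @unpickle (nat * nat)%type k is Some p then nth x0 (s p.1) p.2 else x0.
exists q => x e e0.
have [n /(_ _ (leqnn n)) ne] := invS_lt e0.
have [y ys yx] := svalP (cid (net n)) x.
exists (pickle (n, index y (s n))).
rewrite /q pickleK /= nth_index//; exact: le_ball (ltW ne) _ yx.
Qed.

End SetDistance.

Section WeightedSum.
Context {R : realType} {X : Type} (w : nat -> X -> R).
Hypothesis w0 : forall k x, 0 <= w k x.
Hypothesis w1 : forall k x, w k x <= 1.

Let u x : R ^nat := fun k => w k x / (2 ^+ k.+1).
Definition weighted_sum x : R := limn (series (u x)).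

Let u0 x k : 0 <= u x k. Proof. by rewrite divr_ge0. Qed.
Let u1 x k : u x k <= 1 / (2 ^+ k.+1).
Proof. by rewrite ler_pM2r// invr_gt0 exprn_gt0. Qed.

Let geo k n : \sum_(k <= i < k + n) (1 / (2 ^+ i.+1) : R) = 1 / 2 ^+ k - 1 / 2 ^+ (k + n).
Proof.
elim: n => [|n IH]; first by rewrite addn0 big_geq// subrr.
rewrite addnS big_nat_recr ?leq_addr//= IH exprS.
have h : (2 : R) ^+ (k + n) != 0 by rewrite expf_neq0.
have h' : (2 : R) ^+ k != 0 by rewrite expf_neq0.
by field; rewrite h h'.
Qed.

Let partial_le x n : series (u x) n <= 1.
Proof.
rewrite /series /=; apply: (@le_trans _ _ (\sum_(0 <= i < 0 + n) (1 / (2 ^+ i.+1)))).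
  by rewrite add0n; apply: ler_sum => i _.
by rewrite geo expr0 divr1 gerDl oppr_le0 divr_ge0// exprn_ge0.
Qed.

Let mono x : nondecreasing_seq (series (u x)).
Proof. by apply: nondecreasing_series => i _ _. Qed.

Let bnd x : has_ubound (range (series (u x))).
Proof. by exists 1 => _ [n _ <-]. Qed.

Let cv x : cvgn (series (u x)).
Proof. by apply: nondecreasing_is_cvgn. Qed.

Let partial_lim x n : series (u x) n <= weighted_sum x.
Proof. exact: nondecreasing_cvgn_le. Qed.

Let sub_partial x k n : series (u x) (k + n)%N <= series (u x) k + 1 / 2 ^+ k.
Proof.
rewrite /series /= (big_cat_nat_idem _ _ (n := k)) ?leq_addr//=; last exact: addr0.
rewrite lerD2l (@le_trans _ _ (\sum_(k <= i < k + n) (1 / (2 ^+ i.+1))))//.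
  by apply: ler_sum => i _.
by rewrite geo gerBl divr_ge0// exprn_ge0.
Qed.

Let tail x k : weighted_sum x <= series (u x) k + 1 / 2 ^+ k.
Proof.
apply: limr_le => //; near=> n.
have kn : (k <= n)%N by near: n; exact: nbhs_infty_ge.
by rewrite -(subnKC kn).
Unshelve. all: end_near. Qed.

Lemma weighted_sum_le x y : (forall k, w k x <= w k y) -> weighted_sum x <= weighted_sum y.
Proof.
move=> H; apply: limr_le => //; near=> n.
apply: le_trans (partial_lim y n); rewrite /series /=; apply: ler_sum => i _.
by rewrite ler_pM2r// invr_gt0 exprn_gt0.
Unshelve. all: end_near. Qed.

(** The gap at the single index [k], scaled by its weight, persists in every later partial sum and
    hence in the limit. *)
Lemma weighted_sum_lt x y k : (forall k, w k x <= w k y) -> w k x < w k y ->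
  weighted_sum x < weighted_sum y.
Proof.
move=> H Hk; pose d := (w k y - w k x) / 2 ^+ k.+1.
have d0 : 0 < d by rewrite divr_gt0 ?subr_gt0// exprn_gt0.
apply: (@lt_le_trans _ _ (weighted_sum x + d)); first by rewrite ltrDl.
rewrite -lerBrDr; apply: limr_le => //; near=> n.
have kn : (k < n)%N by near: n; exact: nbhs_infty_gt.
rewrite lerBrDr; apply: le_trans (partial_lim y n).
rewrite /series /= !big_mkord (bigD1 (Ordinal kn))//= [leRHS](bigD1 (Ordinal kn))//=.
rewrite addrAC; apply: lerD.
  by rewrite /d /u; lra.
apply: ler_sum => i _; by rewrite ler_pM2r// invr_gt0 exprn_gt0.
Unshelve. all: end_near. Qed.

(** One [e] pays for the first [k] terms, whose weights sum to at most 1; the other pays for the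
    tail, which is at most [1 / 2 ^+ k]. *)
Lemma weighted_sum_dist x y k e : 0 <= e -> 1 / 2 ^+ k <= e ->
  (forall i, (i < k)%N -> w i x <= w i y + e) -> weighted_sum x <= weighted_sum y + e + e.
Proof.
move=> e0 ke H; apply: le_trans (tail x k) _; rewrite lerD//.
apply: (@le_trans _ _ (series (u y) k + e)); last by rewrite lerD2r.
rewrite /series /= !big_mkord; apply: (@le_trans _ _ (\sum_(i < k) (u y i + e / 2 ^+ i.+1))).
  apply: ler_sum => i _; rewrite /u -mulrDl ler_pM2r ?H// invr_gt0 exprn_gt0//.
rewrite big_split /= lerD2l -mulr_sumr ler_piMr//.
have := geo 0 k; rewrite add0n big_mkord expr0 divr1 => E.
have -> : \sum_(i < k) (2 ^+ i.+1)^-1 = 1 - 1 / 2 ^+ k :> R.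
  by rewrite -E; apply: eq_bigr => i _; rewrite mul1r.
by rewrite gerBl divr_ge0// exprn_ge0.
Qed.

End WeightedSum.

(** * Irreducible locally connected continua are arcs *)

Section LocallyConnectedContinua.
Context {R : realType} {T : pseudoMetricType R}.
Hypothesis hT : hausdorff_space T.

Lemma continuum1 (x : T) : continuum_set [set x].
Proof. by split; [exists x|split; [exact: compact_set1|exact: connected1]]. Qed.

Lemma continuumU (C D : set T) x : continuum_set C -> continuum_set D ->
  C x -> D x -> continuum_set (C `|` D).
Proof.
move=> [_ [kC cC]] [_ [kD cD]] Cx Dx; split; first by exists x; left.
by split; [exact: compactU|apply: connectedU => //; exists x].
Qed.

(** [C] is the closure of a connected relative neighbourhood, chosen inside some [V] whose closure
    is still in [U]. *)
Lemma small_continuum_nbhs (M U : set T) x : continuum_set M ->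
  locally_connected_set M -> M x -> nbhs x U ->
  exists G C : set T, [/\ open G, G x, continuum_set C, G `&` M `<=` C &
    C `<=` M `&` U].
Proof.
move=> [_ [kM _]] lM Mx nU.
have [V nV VU] := @uniform_regular T x _ nU.
have [G [oG Gx GV cG]] := lM _ Mx _ nV.
have clM : closed M by exact: compact_closed.
have CM : closure (G `&` M) `<=` M.
  by rewrite {2}(iffLR (closure_id M) clM); apply: closureS => y [].
exists G, (closure (G `&` M)); split => //.
- split; first by exists x; apply: subset_closure.
  split; last exact: connected_closure.
  by apply: (@subclosed_compact _ _ M) => //; exact: closed_closure.
- exact: subset_closure.
- by move=> y Cy; split; [exact: CM|apply: VU; exact: closureS GV _ Cy].
Qed.

Variable M : set T.
Hypothesis MC : continuum_set M.
Hypothesis ML : locally_connected_set M.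

Definition joins (D : set T) (x y : T) :=
  [/\ continuum_set D, D `<=` M, D x & D y].

Lemma joinsU C D x y z : joins C x y -> joins D y z -> joins (C `|` D) x z.
Proof.
move=> [cC CM Cx Cy] [cD DM Dy Dz]; split; [exact: continuumU Cy Dy| |by left|by right].
by rewrite subUset.
Qed.

Lemma joinsC C x y : joins C x y -> joins C y x.
Proof. by case=> *; split. Qed.

(* Otherwise the points reachable from p inside M without meeting x, together
   with x itself, form a continuum joining p and x and missing y. *)
Lemma joins_avoiding p x y : M p -> M x -> M y -> p <> x -> y <> x ->
  (forall D, joins D p x -> D y) -> exists2 D, joins D p y & ~ D x.
Proof.
move=> Mp Mx My px yx H.
have clM : closed M by apply: compact_closed => //; case: MC => _ [].
pose W := [set q | exists2 D, joins D p q & ~ D x].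
have WM : W `<=` M by move=> q [D [_ DM _ Dq] _]; exact: DM.
have Wx : ~ W x by move=> [D []].
have Wp : W p.
  by exists [set p] => [|/esym//]; split=> //; [exact: continuum1|move=> _ ->].
have loc z : M z -> z <> x -> exists G C : set T,
    [/\ open G, G z, continuum_set C, G `&` M `<=` C & C `<=` M /\ ~ C x].
  move=> Mz zx; have nz : nbhs z (~` [set x]).
    apply: open_nbhs_nbhs; split; last by move=> /= zx'; exact: zx.
    exact/closed_openC/(accessible_closed_set1 (hausdorff_accessible hT)).
  have [G [C [oG Gz cC GC CMx]]] := small_continuum_nbhs MC ML Mz nz.
  exists G, C; split=> //; split=> [y' /CMx[]//|/CMx[_]]; exact.
have stepW z q (C : set T) : continuum_set C -> C `<=` M -> ~ C x -> C z -> C q -> W q -> W z.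
  move=> cC CM Cx Cz Cq [D jD Dx]; exists (D `|` C); last by case.
  by apply: joinsU jD _; split.
have clW : closure W `<=` W `|` [set x].
  move=> z clz; have [zx|zx] := pselect (z = x); first by right.
  have Mz : M z by rewrite (iffLR (closure_id M) clM); exact: closureS WM _ clz.
  have [G [C [oG Gz cC GC [CM Cx]]]] := loc _ Mz zx.
  have [q [Wq Gq]] := clz _ (open_nbhs_nbhs (conj oG Gz)).
  by left; apply: (stepW z q C) => //; apply: GC; split=> //; exact: WM.
have cW : connected W.
  have -> : W = \bigcup_(D in [set D | D p /\ D `<=` W /\ connected D]) D.
    apply/seteqP; split=> [q [D jD Dx]|q [D [_ [DW _]]]]; last exact: DW.
    have [[_ [_ cD]] DM Dp Dq] := jD; exists D => //; split=> //; split=> // q' Dq'.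
    by exists D => //; case: jD => *; split.
  by apply: bigcup_connected; [exists p => D []|move=> D [_ []]].
(* Otherwise [W] is both open and closed in the connected set [M], so [W = M], although [x] is not
   in [W]. *)
have clWx : closure W x.
  apply: contrapT => nx; apply: (Wx).
  suff -> : W = M by [].
  case: MC => _ [_ /(_ W)]; apply; first by exists p.
    exists (W `|` ~` M).
      rewrite openE => q [Wq|Mq]; last first.
        apply: filterS (open_nbhs_nbhs (conj (closed_openC clM) Mq)).
        by move=> ?; right.
      have Mq := WM _ Wq; have qx : q <> x by move=> qx; apply: Wx; rewrite -qx.
      have [G [C [oG Gq cC GC [CM Cx]]]] := loc _ Mq qx.
      apply: filterS (open_nbhs_nbhs (conj oG Gq)) => z Gz.
      have [Mz|] := pselect (M z); last by right.
      by left; apply: (stepW z q C) => //; apply: GC.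
    apply/seteqP; split=> [q Wq|q [Mq []//]]; split; [exact: WM|by left].
  exists (closure W); first exact: closed_closure.
  apply/seteqP; split=> [q Wq|q [Mq /[dup] clq /clW[//|qx]]].
    by split; [exact: WM|exact: subset_closure].
  by case: nx; rewrite -qx.
have : closure W y.
  apply: H; split => //; last exact: subset_closure.
    split; first by exists p; exact: subset_closure.
    split; last exact: connected_closure.
    case: MC => _ [kM _]; apply: (@subclosed_compact _ _ M) => //; first exact: closed_closure.
    by move=> q /clW[/WM//|->].
  by move=> q /clW[/WM//|->].
by move=> /clW[|].
Qed.

Variables a b : T.
Hypothesis (Ma : M a) (Mb : M b).

(** When [M] is an arc starting at [a], this is its subarc from [a] to [x]. *)
Definition shadow (x : T) : set T := [set y | forall D, joins D a x -> D y].

Lemma shadow_refl x : shadow x x. Proof. by move=> D []. Qed.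

Lemma shadow_trans x y : shadow x y -> shadow y `<=` shadow x.
Proof. by move=> xy z yz D jD; apply: yz; move: (xy _ jD); case: jD => *; split. Qed.

Lemma shadow_closed x : closed (shadow x).
Proof.
have -> : shadow x = \bigcap_(D in [set D | joins D a x]) D by [].
by apply: closed_bigI => D [[_ [kD _]] _ _ _]; exact: compact_closed.
Qed.

Lemma shadow_step C x y : joins C x y -> shadow y `<=` shadow x `|` C.
Proof.
move=> jC z yz; have [Cz|Cz] := pselect (C z); first by right.
by left=> D jD; have [] := yz _ (joinsU jD jC).
Qed.

Lemma shadow_root x : shadow x a.
Proof. by move=> D []. Qed.

Lemma shadow_root_sub : shadow a `<=` [set a].
Proof. by move=> z; apply; split=> //; [exact: continuum1|move=> _ ->]. Qed.

(** If every continuum from [a] to [x] passes through a different point [y], then [joins_avoiding]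
    reaches [y] without meeting [x], so [x] is not in the shadow of [y]. *)
Lemma shadow_antisym x y : M x -> M y -> shadow x y -> shadow y x -> x = y.
Proof.
move=> Mx My xy yx; apply: contrapT => nxy.
have ax : a <> x.
  by move=> ax; move: xy; rewrite -ax => /shadow_root_sub/= ya; apply: nxy; rewrite -ax ya.
have [|D jD Dx] := joins_avoiding Ma Mx My ax (nesym nxy); first exact: xy.
by apply: Dx; exact: yx.
Qed.

Hypothesis irr : forall D, joins D a b -> D = M.

(** Suppose [D] joins [a] to [x] off [y], and [D'] joins [a] to [y] off [x]. By irreducibility every
    continuum from [b] to [x] completes [D] to [M] and so contains [y]. Hence some [E] joins [b] to
    [y] off [x], and the union of [D'] and [E] contradicts irreducibility. *)
Lemma shadow_total x y : M x -> M y -> shadow x y \/ shadow y x.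
Proof.
move=> Mx My; apply: contrapT => /not_orP[].
move=> /existsNP[D /not_implyP[jD Dy]] /existsNP[D' /not_implyP[jD' D'x]].
have xy : y <> x by move=> yx; apply: Dy; rewrite yx; case: jD.
have bx : b <> x.
  by move=> bx; rewrite -bx in jD; apply: Dy; rewrite (irr jD).
have [E jE|E jE Ex] := joins_avoiding Mb Mx My bx xy.
  by have /irr DE := joinsU jD (joinsC jE); have : M y by []; rewrite -DE => -[].
by have /irr DE := joinsU jD' (joinsC jE); have : M x by []; rewrite -DE => -[].
Qed.

Hypothesis cT : compact [set: T].

(* On an irreducible M the shadows form a chain ordering M from a to b; the
   weighted sum of distances to them is strictly monotone along that chain. *)
Lemma irreducible_coordinate : a <> b -> exists g : T -> R,
  [/\ {within M, continuous g}, {in M &, injective g}, g a = 0, g b = 1 &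
      forall x, M x -> 0 <= g x <= 1].
Proof.
move=> ab.
have [q qd] := compact_dense_sequence cT a.
pose w k x := setdist (q k) (shadow x).
have w0 k x : 0 <= w k x by exact: setdist_ge0.
have w1 k x : w k x <= 1 by exact: setdist_le1.
pose phi := weighted_sum w.
have lephi x y : shadow x y -> phi x <= phi y.
  by move=> xy; apply: (weighted_sum_le w0 w1) => k; exact: setdistS (shadow_trans xy).
have ltphi x y : M x -> M y -> x <> y -> shadow x y -> phi x < phi y.
  move=> Mx My nxy xy; have yx : ~ shadow y x.
    by move=> yx; apply: nxy; exact: shadow_antisym.
  have d0 := setdist_gt0 (@shadow_closed y) yx.
  set d := setdist x (shadow y) in d0.
  have d30 : 0 < d / 3 by lra.
  (* A dense point within [d / 3] of [x] is at distance at most [d / 3] from the shadow of [x], but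
     at least [2 * d / 3] from that of [y]. *)
  have [k kx] := qd x _ d30.
  apply: (@weighted_sum_lt _ _ _ w0 w1 x y k).
    by move=> j; exact: setdistS (shadow_trans xy).
  apply: (@le_lt_trans _ _ (d / 3)).
    exact: setdist_le d30 (@shadow_refl x) kx.
  have := setdist_lip (shadow y) d30 (ball_sym kx); rewrite -/d /w; lra.
have injphi x y : M x -> M y -> phi x = phi y -> x = y.
  move=> Mx My e; apply: contrapT => nxy.
  have [xy|yx] := shadow_total Mx My.
    by have := ltphi _ _ Mx My nxy xy; rewrite e ltxx.
  by have := ltphi _ _ My Mx (nesym nxy) yx; rewrite e ltxx.
have cphi : {within M, continuous phi}.
  apply/subspace_continuousP => x Mx; apply/cvgrPdist_le => e e0.
  have [d d0 dE] : exists2 d, 0 < d & e = d + d + (d + d) by exists (e / 4); lra.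
  have [k ke] : exists k, 1 / 2 ^+ k <= d + d :> R.
    have [k /(_ _ (leqnn k)) ke] := invS_lt (addr_gt0 d0 d0).
    exists k; rewrite div1r; apply: le_trans (ltW ke).
    rewrite lef_pV2 ?posrE ?ltr0n ?exprn_gt0//.
    by rewrite -natrX ler_nat ltn_expl.
  have [G [C [oG Gx cC GC CMU]]] := small_continuum_nbhs MC ML Mx (nbhsx_ballx x _ d0).
  apply: filterS (open_nbhs_nbhs (conj oG Gx)) => y Gy My.
  have Cx : C x by apply: GC.
  have Cy : C y by apply: GC.
  have jC : joins C x y by split=> // z /CMU[].
  have bC z z' : C z -> C z' -> ball z (d + d) z'.
    by move=> /CMU[_ xz] /CMU[_ xz']; exact: ball_triangle (ball_sym xz) xz'.
  (* By [shadow_step] the two shadows differ only inside the small continuum [C], so every distance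
     [w k] moves by at most [d + d]. *)
  have near z z' : C z -> C z' -> joins C z z' -> phi z <= phi z' + (d + d) + (d + d).
    move=> Cz Cz' jz; apply: (weighted_sum_dist w0 w1 (k := k)) => //; first lra.
    move=> i _; apply: setdist_approx; first lra.
    move=> p /(shadow_step jz)[zp|Cp]; first by exists p => //; apply: ballxx; lra.
    by exists z; [exact: shadow_refl|exact: bC].
  have := near _ _ Cx Cy jC; have := near _ _ Cy Cx (joinsC jC).
  by rewrite ler_distlC dE /from_subspace; lra.
have Db0 : 0 < phi a - phi b.
  by rewrite subr_gt0 ltphi//; [exact: nesym|exact: shadow_root].
(* Shadows grow from [a] to [b], so [phi] decreases along [M]; this normalization reverses it. *)
exists (fun x => (phi a - phi x) / (phi a - phi b)); split.
- apply/subspace_continuousP => x Mx; apply: cvgM; last exact: cvg_cst.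
  apply: cvgB; first exact: cvg_cst.
  by move/subspace_continuousP : cphi => /(_ x Mx).
- move=> x y /set_mem Mx /set_mem My /(divIf (lt0r_neq0 Db0)) e.
  by apply: injphi => //; lra.
- by rewrite subrr mul0r.
- by rewrite divff// lt0r_neq0.
- move=> x Mx; apply/andP; split.
    apply: divr_ge0 (ltW Db0); rewrite subr_ge0; apply: lephi.
    exact: shadow_root.
  rewrite ler_pdivrMr// mul1r lerD2l lerN2; apply: lephi => D jD.
  by rewrite (irr jD).
Qed.

End LocallyConnectedContinua.

(** * Parametrization of arcs *)

Definition clamp01 {R : realType} (t : R) : R := Num.max 0 (Num.min 1 t).

Section Clamp.
Context {R : realType}.
Implicit Types t s : R.

Lemma clamp01_itv t : 0 <= clamp01 t <= 1.
Proof. by rewrite /clamp01 le_max lexx ge_max ler01 ge_min lexx. Qed.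

Lemma clamp01_id t : 0 <= t <= 1 -> clamp01 t = t.
Proof. by move=> /andP[t0 t1]; rewrite /clamp01 (min_idPr t1) (max_idPr t0). Qed.

Lemma clamp01_lip s t : `|clamp01 s - clamp01 t| <= `|s - t|.
Proof.
have spec t' : [\/ clamp01 t' = t', clamp01 t' = 0 /\ t' <= 0 | clamp01 t' = 1 /\ 1 <= t'].
  have [t0|t0] := leP t' 0.
    apply: Or32; split=> //.
    by rewrite /clamp01 (min_idPr _) ?(max_idPl t0)// (le_trans t0).
  have [t1|t1] := leP 1 t'.
    by apply: Or33; split=> //; rewrite /clamp01 (min_idPl t1) (max_idPr ler01).
  by apply: Or31; rewrite clamp01_id// ?(ltW t0) ?(ltW t1).
have := clamp01_itv s; have := clamp01_itv t.
have := ler_norm (s - t); have := ler_norm (t - s); rewrite (distrC t s) ler_norml.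
by have [->|[-> ?]|[-> ?]] := spec s; have [->|[-> ?]|[-> ?]] := spec t; lra.
Qed.

Lemma clamp01_continuous : continuous (@clamp01 R).
Proof.
move=> t; apply/cvgrPdist_le => e e0; near=> s.
apply: le_trans (clamp01_lip _ _) _; near: s.
by apply: cvgr_dist_le => //; exact: cvg_id.
Unshelve. all: end_near. Qed.

End Clamp.

Section Arcs.
Context {R : realType} {T : pseudoMetricType R}.
Hypothesis hT : hausdorff_space T.
Hypothesis cT : compact [set: T].

(** Compactness of the unit interval gives one [d] for all its points, and the 1-Lipschitz clamp
    carries it to the whole line. *)
Lemma clamped_path_unif_continuous (gamma : R -> T) : continuous gamma ->
  (forall t, gamma t = gamma (clamp01 t)) -> forall e : R, 0 < e ->
  exists2 d : R, 0 < d & forall s t, `|s - t| < d -> ball (gamma s) e (gamma t).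
Proof.
move=> cg gc e e0.
have e20 : 0 < e / 2 by rewrite divr_gt0.
pose P (d x : R) := forall y, `|x - y| < d -> ball (gamma x) e (gamma y).
have cov (x : R) : `[0, 1]%classic x -> \forall x' \near x & d \near (0 : R)^'+, P d x'.
  move=> _; have /nbhs_ballP[r /= r0 rg] := cg x _ (nbhsx_ballx (gamma x) _ e20).
  have r20 : 0 < r / 2 by rewrite divr_gt0.
  exists (ball x (r / 2), [set d : R | d < r / 2]) => /=.
    by split; [exact: nbhsx_ballx|exact: nbhs_right_lt].
  move=> [x' d] /= [xx' dr] y x'y; rewrite (splitr e).
  apply: (@ball_triangle _ _ (gamma x)).
    by apply: ball_sym; apply: rg; apply: le_ball xx'; lra.
  apply: rg; rewrite (splitr r); apply: ball_triangle xx' _.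
  exact: lt_trans x'y dr.
have := iffLR (compact_near_coveringP _) (@segment_compact R 0 1) _ _ P _ cov.
move=> H; have [d [d0 dP]] := filter_ex (filterI (nbhs_right_gt (0 : R)) (H _)).
exists d => // s t st; rewrite (gc s) (gc t); apply: dP.
  by rewrite /= in_itv /=; exact: clamp01_itv.
exact: le_lt_trans (clamp01_lip _ _) st.
Qed.

(** Connectedness makes [g] onto the unit interval, and compactness makes its inverse continuous.
    Composing with the clamp makes the path total. *)
Lemma inverse_coordinate (M : set T) (g : T -> R) a b :
  continuum_set M -> {within M, continuous g} -> {in M &, injective g} ->
  M a -> M b -> g a = 0 -> g b = 1 -> (forall x, M x -> 0 <= g x <= 1) ->
  exists gamma : R -> T, [/\ continuous gamma, forall t, M (gamma t),
    forall t, gamma t = gamma (clamp01 t), forall x, M x -> gamma (g x) = x &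
    forall t : R, 0 <= t <= 1 -> g (gamma t) = t].
Proof.
move=> [_ [kM cM]] cg ig Ma Mb ga gb g01.
have surj t : exists x, M x /\ g x = clamp01 t.
  have /connected_intervalP it := connected_continuous_connected cM cg.
  have := it 0 1 _ _ (clamp01 t) (clamp01_itv t).
  by case; [exists a|exists b|move=> x Mx gx; exists x].
pose gamma t := sval (cid (surj t)).
have gM t : M (gamma t) by have [] := svalP (cid (surj t)).
have gE t : g (gamma t) = clamp01 t by have [] := svalP (cid (surj t)).
exists gamma; split => //; last 3 first.
- by move=> t; apply: ig; rewrite ?inE// !gE (clamp01_id (clamp01_itv t)).
- by move=> x Mx; apply: ig; rewrite ?inE// gE clamp01_id// g01.
- by move=> t t01; rewrite gE clamp01_id.
(* The image of the compact set [M \ G] under [g] is closed and misses the clamped parameter, so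
   nearby parameters are sent into [G]. *)
move=> t U nU; have /= := nU; rewrite nbhsE => -[G [oG Gt] GU].
have kK : compact (g @` (M `\` G)).
  apply: continuous_compact; last first.
    by rewrite setDE; apply: compact_closedI => //; exact: open_closedC.
  by apply: continuous_subspaceW cg => x [].
have clK := compact_closed (@Rhausdorff R) kK.
have nt : (~` (g @` (M `\` G))) (clamp01 t).
  move=> [x [Mx Gx]]; rewrite -gE => /ig; rewrite !inE => /(_ Mx (gM t)) xg.
  by apply: Gx; rewrite xg.
have H : nbhs t (@clamp01 R @^-1` (~` (g @` (M `\` G)))).
  exact: clamp01_continuous (open_nbhs_nbhs (conj (closed_openC clK) nt)).
change (nbhs t (gamma @^-1` U)); apply: filterS H => s ns.
apply: GU; apply: contrapT => nG; apply: ns.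
by exists (gamma s).
Qed.

Hypothesis hlc : @hereditarily_locally_connected R T.

Lemma subcontinuum_arc (A : set T) a b : continuum_set A -> A a -> A b -> a <> b ->
  exists (M : set T) (Phi : T -> R) (gamma : R -> T),
  [/\ continuum_set M, M `<=` A, continuous Phi, continuous gamma &
   [/\ forall t, M (gamma t) /\ gamma t = gamma (clamp01 t), forall x, M x -> gamma (Phi x) = x,
       forall t : R, 0 <= t <= 1 -> Phi (gamma t) = t, gamma 0 = a & gamma 1 = b]].
Proof.
move=> cA Aa Ab ab.
have [M [cM MA Ma Mb irr]] := irreducible_subcontinuum hT cA Aa Ab.
have irr' D : joins M D a b -> D = M by move=> [cD DM Da Db]; exact: irr.
have [g [cg ig ga gb g01]] :=
  irreducible_coordinate hT cM (hlc cM) Ma Mb irr' cT ab.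
have [gamma [cgam gM gc gg gt]] := inverse_coordinate cM cg ig Ma Mb ga gb g01.
have clM : closed M by apply: compact_closed => //; case: cM => _ [].
have [|Phi [eP cP _]] :=
  continuous_bounded_extension (@pseudometric_normal R T) clM ltr01 cg.
  by move=> x /g01/andP[g0 g1]; rewrite ger0_norm.
have PE x : M x -> Phi x = g x by move=> Mx; rewrite eP// inE.
exists M, Phi, gamma; split => //; split => //.
- by move=> x Mx; rewrite PE// gg.
- by move=> t t01; rewrite PE// gt.
- by rewrite -ga gg.
- by rewrite -gb gg.
Qed.

End Arcs.

(** * A map shadowing an arc *)

Lemma continuous_paste {R : realType} {X Y : topologicalType} (h : X -> R) (f g : X -> Y) :
  continuous h -> continuous f -> continuous g -> (forall x, h x = 0 -> f x = g x) ->
  continuous (fun x => if h x <= 0 then f x else g x).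
Proof.
move=> ch cf cg fg x; have [hx|hx|hx] := ltgtP (h x) 0.
- have H : \forall y \near x, h y < 0 by exact: (cvgr_lt _ (ch x) _ hx).
  rewrite /continuous_at (ltW hx); apply: cvg_trans (cf x); apply: near_eq_cvg.
  by apply: filterS H => y hy; rewrite ltW.
- have H : \forall y \near x, 0 < h y by exact: (cvgr_gt _ (ch x) _ hx).
  rewrite /continuous_at leNgt hx; apply: cvg_trans (cg x); apply: near_eq_cvg.
  by apply: filterS H => y hy; rewrite leNgt hy.
- rewrite /continuous_at hx lexx => U nU.
  have Uf : nbhs x (f @^-1` U) by exact: cf nU.
  have Ug : nbhs x (g @^-1` U) by apply: cg; rewrite -fg.
  change (nbhs x ((fun x => if h x <= 0 then f x else g x) @^-1` U)).
  by apply: filterS (filterI Uf Ug) => y [Ufy Ugy] /=; case: ifP.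
Qed.

Section Shadowing.
Context {R : realType} {T : pseudoMetricType R}.
Variables (M : set T) (Phi : T -> R) (gamma : R -> T).
Variables (x : nat -> T) (J : nat -> R -> T) (t : nat -> R).
Hypothesis clM : closed M.
Hypothesis cPhi : continuous Phi.
Hypothesis cgamma : continuous gamma.
Hypothesis ugamma : forall e : R, 0 < e ->
  exists2 d : R, 0 < d & forall s t, `|s - t| < d -> ball (gamma s) e (gamma t).
Hypothesis gammaPhi : forall y, M y -> gamma (Phi y) = y.
Hypothesis xM : forall n, ~ M (x n).
Hypothesis x_half : forall n, setdist (x n.+1) M < setdist (x n) M / 2.
Hypothesis x_small : forall n, setdist (x n) M < n.+1%:R^-1.
Hypothesis cJ : forall n, continuous (J n).
Hypothesis J0 : forall n, J n 0 = gamma (t n).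
Hypothesis J1 : forall n, J n 1 = x n.
Hypothesis J_small : forall n s, ball (gamma (t n)) n.+1%:R^-1 (J n s).
Hypothesis xt : forall n, `|Phi (x n) - t n| < n.+1%:R^-1.
Hypothesis t_slow : forall e : R, 0 < e ->
  exists N, forall n, (N <= n)%N -> `|t n - t n.+1| < e.

Let psi y := setdist y M.
Let delta n := psi (x n).
Let cpsi : continuous psi. Proof. exact: setdist_continuous. Qed.

Let delta_gt0 n : 0 < delta n. Proof. exact: setdist_gt0. Qed.

Let delta_dec n k : delta (n + k)%N <= delta n.
Proof.
elim: k => [|k IH]; first by rewrite addn0.
rewrite addnS; apply: le_trans IH; have := x_half (n + k).
have := delta_gt0 (n + k); rewrite /delta /psi; lra.
Qed.

Let delta_le m n : (n <= m)%N -> delta m <= delta n.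
Proof. by move=> nm; rewrite -(subnKC nm). Qed.

(** Peaks at [x n] with value 1. It is positive only where [psi] is within a quarter of [delta n]
    from [delta n] and [Phi] is within [1 / (n + 1)] of its value at [x n]. *)
Let bump n y : R :=
  1 - 4 / delta n * `|psi y - delta n| - n.+1%:R * `|Phi y - Phi (x n)|.

Let lam n y : R := Num.max 0 (bump n y).

Let clam n : continuous (lam n).
Proof.
move=> y; apply: continuous_max; first exact: cvg_cst.
apply: cvgB.
  apply: cvgB; first exact: cvg_cst.
  apply: cvgM; first exact: cvg_cst.
  by apply: cvg_norm; apply: cvgB; [exact: cpsi|exact: cvg_cst].
apply: cvgM; first exact: cvg_cst.
by apply: cvg_norm; apply: cvgB; [exact: cPhi|exact: cvg_cst].
Qed.

Let lam_ge0 n y : 0 <= lam n y. Proof. by rewrite le_max lexx. Qed.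

Let lam_x n : lam n (x n) = 1.
Proof. by rewrite /lam /bump !subrr normr0 !mulr0 !subr0 (max_idPr ler01). Qed.

Let lam_gt0 n y : 0 < lam n y ->
  [/\ delta n * (3 / 4) < psi y, psi y < delta n * (5 / 4) & `|Phi y - Phi (x n)| < n.+1%:R^-1].
Proof.
rewrite /lam lt_max ltxx /= /bump => h.
have d0 := delta_gt0 n.
have h1 : 0 <= n.+1%:R * `|Phi y - Phi (x n)| by rewrite mulr_ge0.
have h2 : 0 <= 4 / delta n * `|psi y - delta n|.
  by rewrite mulr_ge0// divr_ge0// ltW.
have h3 : `|psi y - delta n| < delta n / 4.
  have : 4 / delta n * `|psi y - delta n| < 1 by lra.
  rewrite -ltr_pdivlMl ?divr_gt0// invf_div mulr1; lra.
split.
- by move: h3; rewrite ltr_norml; lra.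
- by move: h3; rewrite ltr_norml; lra.
- have : n.+1%:R * `|Phi y - Phi (x n)| < 1 by lra.
  by rewrite -ltr_pdivlMl ?ltr0n// mulr1.
Qed.

(** Since [delta] more than halves at each step, the bands between [3/4] and [5/4] of successive
    values are disjoint. *)
Let lam_disj m n y : (n < m)%N -> 0 < lam n y -> lam m y = 0.
Proof.
move=> nm /lam_gt0[h1 _ _]; apply/eqP; rewrite eq_le lam_ge0 andbT leNgt; apply/negP.
move=> /lam_gt0[_ h2 _].
have := delta_le nm; have := x_half n; have := delta_gt0 m.
by move: h1 h2; rewrite /delta /psi; lra.
Qed.

Let lam_uniq m n y : 0 < lam n y -> m <> n -> lam m y = 0.
Proof.
move=> h /eqP; rewrite neq_ltn => /orP[mn|nm]; last exact: lam_disj nm h.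
apply/eqP; rewrite eq_le lam_ge0 andbT leNgt; apply/negP => hm.
by move: h; rewrite (lam_disj mn hm) ltxx.
Qed.

(** As [lam n] grows from 0 to 1/2, the retracted point slides along the arc to [gamma (t n.+1)];
    from 1/2 to 1 it climbs [J n.+1], reaching [x n.+1] when [y] is [x n]. *)
Let F n y : T :=
  if lam n y - 1 / 2 <= 0
  then gamma ((1 - 2 * lam n y) * Phi y + 2 * lam n y * t n.+1)
  else J n.+1 (2 * lam n y - 1).

Let cF n : continuous (F n).
Proof.
have cl := @clam n.
have c2 : continuous (fun y => 2 * lam n y).
  by move=> y; apply: cvgM; [exact: cvg_cst|exact: cl].
apply: continuous_paste.
- by move=> y; apply: cvgB; [exact: cl|exact: cvg_cst].
- move=> y; apply: continuous_comp; last exact: cgamma.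
  apply: cvgD; apply: cvgM; [|exact: cPhi|exact: c2|exact: cvg_cst].
  by apply: cvgB; [exact: cvg_cst|exact: c2].
- move=> y; apply: continuous_comp; last exact: cJ.
  by apply: cvgB; [exact: c2|exact: cvg_cst].
move=> y h; have -> : lam n y = 1 / 2 by lra.
have -> : 2 * (1 / 2) - 1 = 0 :> R by lra.
rewrite J0; congr gamma; lra.
Qed.

Let F0 n y : lam n y = 0 -> F n y = gamma (Phi y).
Proof.
move=> h; rewrite /F h ifT; last by lra.
by congr gamma; ring.
Qed.

Let Fx n : F n (x n) = x n.+1.
Proof.
rewrite /F lam_x ifF; last by apply/negbTE; rewrite -ltNge; lra.
by rewrite -(J1 n.+1); congr J; ring.
Qed.

(** Where [lam n] is active, [Phi y] is close to [Phi (x n)], then to [t n], then to [t n.+1]; so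
    the slide is short, and [J n.+1] is small. *)
Let F_close (e : R) : 0 < e -> exists N, forall n y, (N <= n)%N -> 0 < lam n y ->
  ball (gamma (Phi y)) e (F n y).
Proof.
move=> e0; have e20 : 0 < e / 2 by lra.
have [d d0 dg] := ugamma e20.
have d30 : 0 < d / 3 by lra.
have [N1 H1] := t_slow d30; have [N2 H2] := invS_lt d30; have [N3 H3] := invS_lt e20.
exists (maxn N1 (maxn N2 N3)) => n y; rewrite !geq_max => /and3P[n1 n2 n3] h.
have [_ _ hP] := lam_gt0 h.
have close : `|Phi y - t n.+1| < d.
  have := H1 _ n1; have := H2 _ n2; have := xt n => a1 a2 a3.
  have -> : Phi y - t n.+1 = (Phi y - Phi (x n)) + (Phi (x n) - t n) + (t n - t n.+1) by ring.
  apply: le_lt_trans (ler_normD _ _) _.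
  have := lt_trans hP a2; have := lt_trans a1 a2; clear a1 a2 hP.
  have := ler_normD (Phi y - Phi (x n)) (Phi (x n) - t n); lra.
rewrite /F; case: ifPn => hl.
  apply: le_ball (_ : e / 2 <= e) _ _; first lra.
  apply: dg; have -> : Phi y - ((1 - 2 * lam n y) * Phi y + 2 * lam n y * t n.+1) =
     (2 * lam n y) * (Phi y - t n.+1) by ring.
  apply: le_lt_trans close; rewrite normrM ler_piMl// ger0_norm; first lra.
  by rewrite mulr_ge0.
rewrite (splitr e); apply: ball_triangle (dg _ _ close) _.
apply: le_ball (J_small _ _); apply: ltW; apply: H3; lia.
Qed.

(** The chosen index is harmless, because at most one [lam n] is positive at [y]. *)
Let f y : T :=
  if pselect (exists n, 0 < lam n y) is left h then F (sval (cid h)) y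
  else gamma (Phi y).

Let fE n y : (forall m, m <> n -> lam m y = 0) -> f y = F n y.
Proof.
move=> h; rewrite /f; case: pselect => [p|np].
  have q := svalP (cid p); move: (sval _) q => m q.
  have [->//|mn] := pselect (m = n).
  by move: q; rewrite h// ltxx.
rewrite F0//; apply/eqP; rewrite eq_le lam_ge0 andbT leNgt; apply/negP => h'.
by apply: np; exists n.
Qed.

Let fcases y : f y = gamma (Phi y) \/ exists2 n, 0 < lam n y & f y = F n y.
Proof.
rewrite /f; case: pselect => [p|np]; last by left.
by right; exists (sval (cid p)) => //; exact: svalP (cid p).
Qed.

Let lamM n y : M y -> lam n y = 0.
Proof.
move=> My; apply/eqP; rewrite eq_le lam_ge0 andbT leNgt; apply/negP => /lam_gt0[h _ _].
by move: h; rewrite /psi setdist0//; have := delta_gt0 n; lra.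
Qed.

Let fM y : M y -> f y = y.
Proof. by move=> My; rewrite (@fE 0%N) ?F0 ?lamM ?gammaPhi// => m _; exact: lamM. Qed.

Let fx n : f (x n) = x n.+1.
Proof.
rewrite (@fE n) ?Fx// => m mn; apply: (@lam_uniq _ n) => //.
by rewrite lam_x.
Qed.

Let cf : continuous f.
Proof.
move=> y; have [My|My] := pselect (M y).
  rewrite /continuous_at fM//; apply/cvg_ballP => e e0.
  have e20 : 0 < e / 2 by lra.
  have [N HN] := F_close e20.
  (* So close to [M] only bumps of index at least [N] are active, and [F_close] controls them. *)
  have H1 : \forall z \near y, psi z < delta N * (3 / 4).
    apply: (cvgr_lt _ (cpsi (x := y))); rewrite /psi setdist0//.
    by rewrite mulr_gt0//; lra.
  have H2 : \forall z \near y, ball y (e / 2) (gamma (Phi z)).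
    have cgP : continuous (gamma \o Phi).
      by move=> z; apply: continuous_comp; [exact: cPhi|exact: cgamma].
    by have := cgP y _ (nbhsx_ballx (gamma (Phi y)) _ e20); rewrite {1}(gammaPhi My).
  apply: filterS (filterI H1 H2) => z [h1 h2].
  have [->|[n hn ->]] := fcases z; first by apply: le_ball h2; lra.
  rewrite (splitr e); apply: ball_triangle h2 _; apply: HN => //.
  rewrite leqNgt; apply/negP => nN; have [h _ _] := lam_gt0 hn.
  by have := delta_le (ltnW nN); lra.
have psi0 : 0 < psi y by exact: setdist_gt0.
(* For the least such [n], bands of larger index lie below [psi y] and, by minimality, bands of
   smaller index lie above it. So [f] agrees with [F n] near [y]. *)
have ex : exists n, delta n.+1 * (5 / 4) < psi y.
  have h0 : 0 < psi y / 2 by lra.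
  have [N HN] := invS_lt h0; exists N.
  have : delta N.+1 < psi y / 2 := lt_trans (x_small N.+1) (HN _ (leqnSn N)).
  by have := delta_gt0 N.+1; lra.
have [n hn nmin] := ex_minnP ex.
have H : \forall z \near y, forall m, m <> n -> lam m z = 0.
  have H1 : \forall z \near y, delta n.+1 * (5 / 4) < psi z.
    exact: (cvgr_gt _ (cpsi (x := y)) _ hn).
  have H2 : \forall z \near y, forall m, (m < n)%N -> psi z < delta m * (3 / 4).
    case: n hn nmin H1 => [|n] hn nmin H1; first exact: nearW.
    have h : psi y < delta n * (3 / 4).
      have : psi y <= delta n.+1 * (5 / 4).
        by rewrite leNgt; apply/negP => /nmin; rewrite ltnn.
      by have := x_half n; have := delta_gt0 n.+1; rewrite /delta /psi; lra.
    have : \forall z \near y, psi z < delta n * (3 / 4).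
      exact: (cvgr_lt _ (cpsi (x := y)) _ h).
    apply: filterS => z hz m; rewrite ltnS => mn.
    by have := delta_le mn; lra.
  apply: filterS (filterI H1 H2) => z [h1 h2] m /eqP.
  rewrite neq_ltn => /orP[mn|nm]; apply/eqP; rewrite eq_le lam_ge0 andbT leNgt;
    apply/negP => /lam_gt0[k1 k2 _].
    by have := h2 _ mn; lra.
  by have := delta_le nm; lra.
rewrite /continuous_at (fE (nbhs_singleton H)).
apply: cvg_trans (cF (x := y)); apply: near_eq_cvg.
by apply: filterS H => z /fE.
Qed.

Lemma shadowing_map : exists f : T -> T,
  [/\ continuous f, forall y, M y -> f y = y & forall n, f (x n) = x n.+1].
Proof. by exists f. Qed.

End Shadowing.

(** * A slow oscillation through the unit interval *)

(* wave_index n = (m, i) with n = m^2 + i and i <= 2m: the m-th period of a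
   triangle wave sampled at 2m + 1 points. *)
Definition wave_step (p : nat * nat) := if (p.2 < 2 * p.1)%N then (p.1, p.2.+1) else (p.1.+1, 0%N).

Definition wave_index n := iter n wave_step (0%N, 0%N).

Lemma wave_indexP n : let p := wave_index n in ((p.2 <= 2 * p.1) /\ n = p.1 ^ 2 + p.2)%N.
Proof.
elim: n => [//|n /= [IH1 IH2]]; rewrite /wave_step; case: ltnP => /= h; split; lia.
Qed.

Lemma wave_index_uniq m i : (i <= 2 * m)%N -> wave_index (m ^ 2 + i) = (m, i).
Proof.
move=> h; have [] := wave_indexP (m ^ 2 + i); case: (wave_index _) => m' i' /= h' e.
have mm : m' = m by nia.
by rewrite mm in e *; congr pair; lia.
Qed.

Lemma wave_index_large K n : (K ^ 2 <= n)%N -> (K <= (wave_index n).1)%N.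
Proof. have [h e] := wave_indexP n; nia. Qed.

(** In period [m > 0] the value [|i - m| / m] falls from 1 to 0 and returns to 1 in steps of
    [1 / m]. Consecutive such periods join at 1 without a jump. *)
Lemma slow_oscillation (R : realType) : exists t : nat -> R,
  [/\ forall n, 0 <= t n <= 1,
   forall e : R, 0 < e -> exists N, forall n, (N <= n)%N -> `|t n - t n.+1| < e &
   forall (c e : R) N, 0 <= c <= 1 -> 0 < e -> exists2 n, (N <= n)%N & `|t n - c| < e].
Proof.
pose t n : R := `|(wave_index n).2%:R - (wave_index n).1%:R| / (wave_index n).1%:R.
have inv e : 0 < e -> exists K, forall m, (K <= m)%N -> (0 < m)%N /\ m%:R^-1 < e :> R.
  move=> e0; have [K /(_ _ (leqnn K)) ne] := invS_lt e0.
  exists K.+1 => m Km; have m0 : (0 < m)%N by apply: leq_trans Km.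
  by split=> //; apply: le_lt_trans ne; rewrite lef_pV2 ?posrE ?ltr0n// ler_nat.
have tge n : 0 <= t n by rewrite divr_ge0.
exists t; split.
- move=> n; rewrite tge /=; have [h e] := wave_indexP n.
  (* In the period [m = 0] the convention that the inverse of 0 is 0 gives the value 0. *)
  rewrite /t; move: h; case: (wave_index n) => -[|m] i /= h; first by rewrite invr0 mulr0.
  rewrite ler_pdivrMr ?ltr0n// mul1r ler_norml.
  have : (i%:R : R) <= (2 * m.+1)%:R by rewrite ler_nat.
  have : (0 : R) <= i%:R by [].
  rewrite natrM; lra.
- move=> e /inv[K HK]; exists (K ^ 2)%N => n /wave_index_large; rewrite /t /=.
  have [h _] := wave_indexP n; move: h; rewrite /wave_step.
  case: (wave_index n) => m i /= h Km; have [m0 me] := HK _ Km.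
  have mR : (0 : R) < m%:R by rewrite ltr0n.
  case: ltnP => /= him.
    rewrite -mulrBl normrM (gtr0_norm (_ : 0 < m%:R^-1)) ?invr_gt0//.
    apply: le_lt_trans me; rewrite ler_piMl ?invr_ge0 ?ler0n//.
    apply: le_trans (ler_dist_dist _ _) _; rewrite -natr1.
    by rewrite [X in `|X|](_ : _ = -1) ?normrN1//; ring.
  have -> : i = (2 * m)%N by lia.
  have E : 2 * m%:R - m%:R = m%:R :> R by ring.
  rewrite natrM sub0r normrN E.
  rewrite !normr_nat !divff ?pnatr_eq0 -?lt0n// subrr normr0.
  by apply: le_lt_trans me; rewrite invr_ge0.
- move=> c e N /andP[c0 c1] /inv[K HK].
  pose m := maxn K N; have [m0 me] := HK m (leq_maxl _ _).
  have mR : (0 : R) < m%:R by rewrite ltr0n.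
  (* Sample [m + j] of period [m] has the value [j / m], within [1 / m] of [c]. *)
  pose j := Num.truncn (c * m%:R).
  have /andP[j1 j2] : j%:R <= c * m%:R < j.+1%:R by apply: truncn_itv; rewrite mulr_ge0// ltW.
  have jm : (j <= m)%N.
    by rewrite -(ler_nat R) (le_trans j1)// ler_piMl// ltW.
  exists (m ^ 2 + (m + j))%N; first by rewrite /m in jm m0 *; nia.
  rewrite /t wave_index_uniq; last by lia.
  have E : (m + j)%:R - m%:R = j%:R :> R by rewrite natrD; ring.
  rewrite /= E normr_nat; apply: le_lt_trans me.
  rewrite -(ler_pM2r mR) mulVf ?gt_eqF// -{2}(ger0_norm (ltW mR)) -normrM mulrBl divfK ?gt_eqF//.
  by rewrite ler_norml; move: j2; rewrite -natr1; lra.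
Qed.

(** * Necessity of complete regularity *)

Section Necessity.
Context {R : realType} {T : pseudoMetricType R}.
Hypothesis hT : hausdorff_space T.
Hypothesis TC : continuum_set [set: T].
Hypothesis hlc : @hereditarily_locally_connected R T.

Let cT : compact [set: T]. Proof. by case: TC => _ []. Qed.

(** A small continuum that is a neighbourhood of [p] contains a point off [M], since [M] has empty
    interior; an arc inside that continuum is the path. *)
Lemma short_exit_path (M : set T) (Phi : T -> R) (p : T) (e : R) : continuous Phi ->
  M p -> M° = set0 -> 0 < e ->
  exists xJ : T * (R -> T), [/\ ~ M xJ.1, continuous xJ.2,
    xJ.2 0 = p /\ xJ.2 1 = xJ.1, forall s, ball p e (xJ.2 s) &
    `|Phi xJ.1 - Phi p| < e /\ setdist xJ.1 M < e].
Proof.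
move=> cPhi Mp M0 e0.
have nU : nbhs p (ball p e `&` ([set y | `|Phi p - Phi y| < e] `&` [set y | setdist y M < e])).
  apply: filterI; first exact: nbhsx_ballx.
  apply: filterI; first exact: cvgr_dist_lt (cPhi p) _ e0.
  by apply: (cvgr_lt _ (@setdist_continuous R T M p)); rewrite setdist0.
have [G [C [oG Gp cC GC CU]]] := small_continuum_nbhs hT TC (hlc TC) I nU.
have [x Gx Mx] : exists2 x, G x & ~ M x.
  apply: contrapT => H; suff : M° p by rewrite M0.
  apply: filterS (open_nbhs_nbhs (conj oG Gp)) => z Gz.
  by apply: contrapT => Mz; apply: H; exists z.
have Cx : C x by apply: GC.
have Cp : C p by apply: GC.
have px : p <> x by move=> px; apply: Mx; rewrite -px.
have [M' [_ [J [_ M'C _ cJ [JM _ _ J0 J1]]]]] := subcontinuum_arc hT cT hlc cC Cp Cx px.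
exists (x, J); split => //=.
- by move=> s; have [_ []] := CU _ (M'C _ (proj1 (JM s))).
- by have [_ [_ []]] := CU _ Cx; rewrite distrC.
Qed.

Lemma nowhere_dense_subcontinuum_not_FTP (A : set T) :
  continuum_set A -> Defs.nondegenerate A -> A° = set0 ->
  exists (f : T -> T) (x : T), [/\ continuous f, totally_periodic f (omega_limit f x) &
    ~ finite_set (omega_limit f x)].
Proof.
move=> cA [a [b [Aa [Ab ab]]]] A0.
have [M [Phi [gamma [cM MA cPhi cgam [gM gP Pg _ _]]]]] := subcontinuum_arc hT cT hlc cA Aa Ab ab.
have Mg s : M (gamma s) by have [] := gM s.
have ug := clamped_path_unif_continuous cgam (fun s => proj2 (gM s)).
have M0 : M° = set0.
  by apply/seteqP; split=> // y My; rewrite -A0; apply: filterS My.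
have clM : closed M by apply: compact_closed => //; case: cM => _ [].
have [t [t01 t_slow t_dense]] := slow_oscillation R.
have [xJ xJP] : exists xJ : R -> R -> T * (R -> T), forall s e, 0 < e ->
    [/\ ~ M (xJ s e).1, continuous (xJ s e).2,
    (xJ s e).2 0 = gamma s /\ (xJ s e).2 1 = (xJ s e).1,
    forall r, ball (gamma s) e ((xJ s e).2 r) &
    `|Phi (xJ s e).1 - Phi (gamma s)| < e /\ setdist (xJ s e).1 M < e].
  have ch (q : R * R) := @short_exit_path M Phi (gamma q.1) q.2 cPhi (Mg q.1) M0.
  (* The value for [e <= 0] is a dummy; it keeps the choice total, so that [eps] can be defined
     before being proved positive. *)
  exists (fun s e => if pselect (0 < e) is left e0 then sval (cid (ch (s, e) e0)) else (a, fun=> a)).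
  by move=> s e e0; case: pselect => // e0'; exact: svalP (cid (ch (s, e) e0')).
(* Each tolerance is at most half the distance from the previous point to [M], as [x_half] demands,
   and at most [1 / (n + 1)]. *)
pose eps := fix eps n : R := if n is k.+1
  then Num.min (setdist (xJ (t k) (eps k)).1 M / 2) k.+2%:R^-1 else 1.
have eps_gt0 n : 0 < eps n.
  elim: n => [|n IH] /=; first exact: ltr01.
  rewrite lt_min invr_gt0 ltr0n andbT divr_gt0//.
  by have [nM _ _ _ _] := xJP (t n) _ IH; exact: setdist_gt0.
have eps_le n : eps n <= n.+1%:R^-1.
  by case: n => [|n] /=; [rewrite invr1|rewrite ge_min lexx orbT].
pose x n := (xJ (t n) (eps n)).1; pose J n := (xJ (t n) (eps n)).2.
have P n := xJP (t n) _ (eps_gt0 n).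
have xM n : ~ M (x n) by case: (P n).
have [| | | | | | |f [cf fM fx]] :=
  @shadowing_map R T M Phi gamma x J t clM cPhi cgam ug gP xM _ _ _ _ _ _ _ t_slow.
- by move=> n; have [_ _ _ _ [_ h]] := P n.+1; apply: lt_le_trans h _; rewrite /= ge_min lexx.
- by move=> n; have [_ _ _ _ [_ h]] := P n; exact: lt_le_trans h (eps_le n).
- by move=> n; case: (P n).
- by move=> n; case: (P n) => _ _ [].
- by move=> n; case: (P n) => _ _ [].
- by move=> n s; case: (P n) => _ _ _ h _; apply: le_ball (h s); exact: eps_le.
- move=> n; have [_ _ _ _ [h _]] := P n; rewrite Pg// in h.
  exact: lt_le_trans h (eps_le n).
have xg n : ball (gamma (t n)) n.+1%:R^-1 (x n).
  have [_ _ [_ e1] h _] := P n; rewrite /x -e1.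
  by apply: le_ball (h 1); exact: eps_le.
have itx n : iter n f (x 0%N) = x n by elim: n => // n IH; rewrite iterS IH.
exists f, (x 0%N); split => //.
  (* The distances from [x n] to [M] tend to 0, so every limit point is in [M], where [f] is the
     identity. *)
  move=> y [s [s_infty s_cvg]]; exists 1%N; split => //=; apply: fM.
  apply: contrapT => My; have y0 := setdist_gt0 clM My.
  have y20 : 0 < setdist y M / 2 by lra.
  have [N HN] := invS_lt y20.
  have H1 : \forall i \near \oo, setdist y M / 2 < setdist (iter (s i) f (x 0%N)) M.
    have := cvg_comp _ _ s_cvg (@setdist_continuous R T M y).
    by move=> /cvgr_gt; apply; lra.
  have [i /= [i1 i2]] := filter_ex (filterI (s_infty N) H1).
  move: i2; rewrite itx; have [_ _ _ _ [_ h]] := P (s i).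
  have := lt_trans (lt_le_trans h (eps_le _)) (HN _ i1); rewrite -/(x _); lra.
have omega_gamma c : 0 <= c <= 1 -> omega_limit f (x 0%N) (gamma c).
  move=> c01; have /choice[s sP] i : exists n, (i <= n)%N /\ `|t n - c| < i.+1%:R^-1.
    by have [||n] := t_dense c i.+1%:R^-1 i => //; exists n.
  exists s; split.
    move=> N; near=> i; apply: leq_trans (proj1 (sP i)).
    by near: i; exact: nbhs_infty_ge.
  apply/cvg_ballP => e e0; have e20 : 0 < e / 2 by rewrite divr_gt0.
  have [d d0 dg] := ug _ e20.
  have [N1 H1] := invS_lt e20; have [N2 H2] := invS_lt d0.
  near=> i; rewrite itx (splitr e).
  have iN1 : (N1 <= i)%N by near: i; exact: nbhs_infty_ge.
  have iN2 : (N2 <= i)%N by near: i; exact: nbhs_infty_ge.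
  apply: (@ball_triangle _ _ (gamma (t (s i)))).
    by apply: dg; rewrite distrC; apply: lt_trans (proj2 (sP i)) (H2 _ iN2).
  apply: le_ball (xg _); apply/ltW/H1; exact: leq_trans iN1 (proj1 (sP i)).
(* The limit points [gamma (1 / (n + 1))] are distinct, since [Phi] recovers the parameter. *)
move=> fin; apply: infinite_nat.
have inv01 n : 0 <= (n.+1%:R^-1 : R) <= 1.
  by rewrite invr_ge0 ler0n invf_le1// ler1n.
have := @finite_preimage nat T _ (fun n => gamma n.+1%:R^-1) _ fin.
rewrite (_ : _ @^-1` _ = setT); last by apply/seteqP; split=> // n _; exact: omega_gamma.
apply=> n m _ _ /(congr1 Phi); rewrite !Pg// => /invr_inj/eqP.
by rewrite eqr_nat => /eqP[].
Unshelve. all: end_near. Qed.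

End Necessity.

(** * Totally periodic omega-limit sets *)

Section RelativelyClopen.
Context {R : realType} {T : pseudoMetricType R}.
Hypothesis hT : hausdorff_space T.

Definition clopen_in (K B : set T) := [/\ B `<=` K, closed B & closed (K `\` B)].

(** The quasi-component of [p], the intersection of its relatively clopen neighbourhoods, is a
    continuum and hence just [p]. By compactness one of these neighbourhoods already fits in [G]. *)
Lemma clopen_in_nbhs (K : set T) p (G : set T) : compact K -> K p ->
  (forall C, continuum_set C -> C `<=` K -> C p -> C `<=` [set p]) ->
  open G -> G p -> exists B, [/\ clopen_in K B, B p & B `<=` G].
Proof.
move=> kK Kp deg oG Gp; have clK := compact_closed hT kK.
pose F := [set B | clopen_in K B /\ B p].
have FK : F K by split=> //; split=> //; rewrite setDv; exact: closed0.
have F0 : F !=set0 by exists K.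
have Fc A : F A -> compact A by move=> [[AK cA _] _]; exact: subclosed_compact kK AK.
have Fdir A B : F A -> F B -> exists2 C, F C & C `<=` A `&` B.
  move=> [[AK cA cA'] Ap] [[BK cB cB'] Bp]; exists (A `&` B) => //.
  split=> //; split; [by move=> y [/AK]|exact: closedI|].
  by rewrite setDIr; exact: closedU.
have cI : continuum_set (\bigcap_(B in F) B).
  split; first by exists p => B [].
  split.
    apply: (subclosed_compact _ kK); last by move=> y; exact.
    by apply: closed_bigI => B [[]].
  apply: filtered_bigcap_connected => // A U V [[AK cA cA'] Ap] oU oV UV AUV.
  wlog Up : U V oU oV UV AUV / U p.
    move=> H; have [Up|Vp] := AUV _ Ap; first exact: H.
    have [||h|h] := H _ _ oV oU _ _ Vp; [by rewrite setIC|by rewrite setUC|by right|by left].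
  (* On [A] the set [U] is the complement of [V], so this piece is again relatively clopen. *)
  left; exists (A `&` U); last by move=> y [].
  have E : A `&` U = A `&` ~` V.
    apply/seteqP; split=> y [Ay h]; split=> //.
      by move=> Vy; have : (U `&` V) y by []; rewrite UV.
    by case: (AUV _ Ay).
  split=> //; split; first by move=> y [/AK].
    by rewrite E; apply: closedI => //; exact: open_closedC.
  have -> : K `\` (A `&` U) = (K `\` A) `|` (A `&` ~` U).
    rewrite setDIr; apply/seteqP; split=> y.
      move=> [h|[Ky Uy]]; first by left.
      by have [Ay|Ay] := pselect (A y); [right|left].
    by move=> [h|[/AK Ky Uy]]; [left|right].
  by apply: closedU => //; apply: closedI => //; exact: open_closedC.
have [|B [cB Bp] BG] := filtered_bigcap_subset_open hT F0 Fc Fdir oG.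
  have Ip : (\bigcap_(B in F) B) p by move=> B [].
  by move=> y /(deg _ cI _ Ip) -> // z; exact.
by exists B.
Qed.

End RelativelyClopen.

Section OmegaLimits.
Context {R : realType} {T : pseudoMetricType R}.
Hypothesis hT : hausdorff_space T.
Hypothesis cT : compact [set: T].
Variable f : T -> T.
Hypothesis cf : continuous f.
Variable x : T.
Let om := omega_limit f x.

Lemma periodic_orbit_finite y : periodic_point f y ->
  finite_set (range (fun j => iter j f y)).
Proof.
move=> [n [n0 fn]]; apply: (@sub_finite_set _ _ ((fun j => iter j f y) @` `I_n)).
  move=> _ [j _ <-]; exists (j %% n)%N; first exact: ltn_pmod.
  have fk k : iter (k * n) f y = y by elim: k => // k IH; rewrite mulSn addnC iterD fn IH.
  by rewrite [in RHS](divn_eq j n) addnC iterD fk.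
exact/finite_image/finite_II.
Qed.

Lemma finite_set_closed (A : set T) : finite_set A -> closed A.
Proof. by move=> fA; apply: compact_closed => //; exact: finite_compact. Qed.

Lemma iter_continuous n : continuous (iter n f).
Proof.
elim: n => [|n IH] y; first exact: cvg_id.
by apply: (@continuous_comp _ _ _ (iter n f) f); [exact: IH|exact: cf].
Qed.

Lemma open_non_fixed (g : T -> T) : continuous g -> open [set y | g y <> y].
Proof.
move=> cg; rewrite openE => y /= /eqP gy.
move: (hT); rewrite open_hausdorff => /(_ _ _ gy)[[A B] /= [/set_mem Ay /set_mem By] [oA oB AB]].
have nA : nbhs y (g @^-1` A) by apply: cg; exact: open_nbhs_nbhs.
apply: filterS (filterI nA (open_nbhs_nbhs (conj oB By))) => z [Az Bz] /= gz.
have : (A `&` B) z by split=> //; rewrite -gz.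
by rewrite (eqP AB).
Qed.

Lemma omega_limitP y : om y <->
  forall e : R, 0 < e -> forall N, exists2 n, (N <= n)%N & ball y e (iter n f x).
Proof.
split=> [[s [sN sy]] e e0 N|H].
  have H : \forall i \near \oo, ball y e (iter (s i) f x).
    by move/cvg_ballP : sy; exact.
  by have [i [i1 i2]] := filter_ex (filterI (sN N) H); exists (s i).
have /choice[s sP] i : exists n, (i <= n)%N /\ ball y i.+1%:R^-1 (iter n f x).
  by have [|n] := H i.+1%:R^-1 _ i => //; exists n.
exists s; split=> [N|].
  near=> i; apply: leq_trans (proj1 (sP i)).
  by near: i; exact: nbhs_infty_ge.
apply/cvg_ballP => e e0; have [N HN] := invS_lt e0; near=> i.
apply: le_ball (proj2 (sP i)); apply/ltW/HN.
by near: i; exact: nbhs_infty_ge.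
Unshelve. all: end_near. Qed.

Lemma omega_visits y U N : om y -> nbhs y U -> exists2 n, (N <= n)%N & U (iter n f x).
Proof.
move=> /omega_limitP oy /nbhs_ballP[e e0 eU].
by have [n Nn yn] := oy e e0 N; exists n => //; exact: eU.
Qed.

Lemma omega_closed : closed om.
Proof.
move=> y cly; apply/omega_limitP => e e0 N.
have e20 : 0 < e / 2 by rewrite divr_gt0.
have [z [oz yz]] := cly _ (nbhsx_ballx y _ e20).
have [n Nn zn] := iffLR (omega_limitP z) oz _ e20 N.
by exists n => //; rewrite (splitr e); exact: ball_triangle yz zn.
Qed.

Lemma omega_compact : compact om.
Proof. by apply: (subclosed_compact omega_closed cT). Qed.

Lemma omega_invariant y : om y -> om (f y).
Proof.
move=> [s [sN sy]]; exists (fun i => (s i).+1); split.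
  by move=> N; apply: filterS (sN N) => i; exact: leqW.
exact: cvg_comp sy (cf (x := y)).
Qed.

Lemma omega_iter_invariant y n : om y -> om (iter n f y).
Proof. by move=> oy; elim: n => // n IH; rewrite iterS; exact: omega_invariant. Qed.

(** Otherwise infinitely many iterates lie outside [G]; they cluster at a point of [om], which has
    [G] as a neighbourhood. *)
Lemma omega_eventually (G : set T) : open G -> om `<=` G ->
  exists N, forall n, (N <= n)%N -> G (iter n f x).
Proof.
move=> oG oGm; apply: contrapT => H.
have {}H N : exists n, (N <= n)%N /\ ~ G (iter n f x).
  apply: contrapT => H'; apply: H; exists N => n Nn; apply: contrapT => Gn.
  by apply: H'; exists n.
pose D N := [set n | (N <= n)%N /\ ~ G (iter n f x)].
pose F := filter_from [set: nat] (fun N => (fun n => iter n f x) @` D N).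
have FF : ProperFilter F.
  apply: filter_from_proper; last first.
    by move=> N _; have [n Dn] := H N; exists (iter n f x), n.
  apply: filter_from_filter; first by exists 0%N.
  move=> N N' _ _; exists (maxn N N') => //.
  by move=> _ [n [+ Gn] <-]; rewrite geq_max => /andP[n1 n2]; split; exists n.
have [|p [_ clp]] := @cT F FF; first exact: filterT.
suff op : om p.
  have [|z []] := clp (range (fun n => iter n f x) `&` ~` G) G _ (open_nbhs_nbhs (conj oG (oGm _ op))).
    by exists 0%N => // _ [n [_ Gn] <-]; split=> //; exists n.
  by move=> [_ nG] /nG.
apply/omega_limitP => e e0 N.
have [|z [[n [Nn _] <-] pz]] := clp ((fun n => iter n f x) @` D N) (ball p e) _ (nbhsx_ballx p _ e0).
  by exists N.
by exists n.
Qed.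

(* Once the orbit is close to om, it cannot leave a neighbourhood of an
   invariant relatively clopen part of om, yet it must visit all of om. *)
Lemma omega_incompressible V : clopen_in om V -> V !=set0 -> V `<=` f @^-1` V -> V = om.
Proof.
move=> [Vom clV clW] [v Vv] fV; apply/seteqP; split=> // w omw.
apply: contrapT => Vw.
have /(@normal_openP R) nT := @pseudometric_normal R T.
have [|U [U' [oU oU' VU WU' UU']]] := nT _ _ clV clW.
  by apply/seteqP; split=> // y [Vy []].
pose U1 := U `&` f @^-1` U.
have oU1 : open U1 by apply: openI => //; apply: open_comp => // y _; exact: cf.
have [||N HN] := @omega_eventually (U1 `|` U').
- exact: openU.
- move=> y oy; have [Vy|Vy] := pselect (V y); last by right; exact: WU'.
  by left; split; [exact: VU|apply: VU; exact: fV].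
have U1v : nbhs v U1.
  by apply: open_nbhs_nbhs; split=> //; split; [exact: VU|apply: VU; exact: fV].
have [n Nn Un] := omega_visits N (Vom _ Vv) U1v.
have stay k : U1 (iter (n + k) f x).
  elim: k => [|k [_ IH]]; first by rewrite addn0.
  rewrite addnS; have [//|h] := HN (n + k).+1 (leqW (leq_trans Nn (leq_addr _ _))).
  by have : (U `&` U') (iter (n + k).+1 f x) by []; rewrite UU'.
have [m nm U'm] := omega_visits n omw (open_nbhs_nbhs (conj oU' (WU' _ (conj omw Vw)))).
have [Um _] := stay (m - n)%N; rewrite subnKC// in Um.
by have : (U `&` U') (iter m f x) by []; rewrite UU'.
Qed.

Hypothesis tp : totally_periodic f om.

(** The orbit enters [om] at a periodic point [z]. The finite orbit of [z] is closed and contains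
    all later iterates, hence all of [om]. *)
Lemma omega_interior_finite : om° !=set0 -> finite_set om.
Proof.
move=> [p ip]; have [n _ oz] := omega_visits 0 (interior_subset ip) ip.
set z := iter n f x in oz; have fz := periodic_orbit_finite (tp oz).
apply: sub_finite_set fz => y oy; apply: contrapT => ny.
have nb : nbhs y (~` range (fun j => iter j f z)).
  apply: open_nbhs_nbhs; split=> //; apply: closed_openC.
  exact: finite_set_closed (periodic_orbit_finite (tp oz)).
have [m nm] := omega_visits n oy nb; apply.
by exists (m - n)%N => //; rewrite /z -iterD subnK.
Qed.

Hypothesis deg : forall C, continuum_set C -> C `<=` om -> forall p, C p -> C `<=` [set p].

Let nbhs_clopen p (G : set T) : om p -> open G -> G p ->
  exists B, [/\ clopen_in om B, B p & B `<=` G].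
Proof.
move=> op; apply: (clopen_in_nbhs hT omega_compact op) => C cC Com.
exact: deg.
Qed.

Lemma clopen_in_shrink B p (G : set T) : clopen_in om B -> B p -> open G -> G p ->
  exists B', [/\ clopen_in om B', B' p & B' `<=` B `&` G].
Proof.
move=> cB Bp oG Gp; have [Bom clB clB'] := cB.
(* Removing the closed set [om \ B] from [G] forces the new clopen set into [B]. *)
have [||B1 [cB1 B1p B1G]] := @nbhs_clopen p (G `&` ~` (om `\` B)) (Bom _ Bp).
- by apply: openI => //; exact: closed_openC.
- by split=> // -[].
exists B1; split=> // y B1y; have [Gy nB] := B1G _ B1y; split=> //.
apply: contrapT => By; apply: nB; split=> //.
by case: cB1 => + _ _; exact.
Qed.

(* Baire's argument: were no power of f the identity on a relatively clopen
   set, a nested sequence of such sets would trap a non-periodic point. *)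
Lemma clopen_fixed_power : om !=set0 ->
  exists B n, [/\ clopen_in om B, B !=set0, (0 < n)%N & forall y, B y -> iter n f y = y].
Proof.
move=> om0; apply: contrapT => H.
pose good (B : set T) := clopen_in om B /\ B !=set0.
(* Stage [n] discards the fixed points of [iter n.+1 f]. The premise sits under the existential so
   that choice gives a total function. *)
have step (q : set T * nat) : exists B', good q.1 ->
    [/\ good B', B' `<=` q.1 & forall y, B' y -> iter q.2.+1 f y <> y].
  case: q => B n /=; have [[cB B0]|nB] := pselect (good B); last by exists B.
  have [p Bp np] : exists2 p, B p & iter n.+1 f p <> p.
    apply: contrapT => H'; apply: H; exists B, n.+1; split=> // y By.
    by apply: contrapT => ny; apply: H'; exists y.
  pose G := [set y | iter n.+1 f y <> y].
  have oG : open G by exact: open_non_fixed (@iter_continuous n.+1).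
  have [B' [cB' B'p B'G]] := clopen_in_shrink cB Bp oG np.
  exists B' => _; split; [by split=> //; exists p|by move=> y /B'G[]|by move=> y /B'G[]].
have /choice[nx nxP] := step.
pose Bs := fix Bs n := if n is k.+1 then nx (Bs k, k) else om.
have gB n : good (Bs n).
  elim: n => [|n IH] /=; last by have [] := nxP (Bs n, n) IH.
  split=> //; split=> //; [exact: omega_closed|by rewrite setDv; exact: closed0].
have sB n : Bs n.+1 `<=` Bs n by have [] := nxP (Bs n, n) (gB n).
have decB n k : Bs (n + k)%N `<=` Bs n.
  elim: k => [|k IH]; first by rewrite addn0.
  by rewrite addnS; exact: subset_trans (sB _) IH.
have leB m n : (m <= n)%N -> Bs n `<=` Bs m by move=> mn; rewrite -(subnKC mn).
have F0 : (range Bs) !=set0 by exists om, 0%N.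
have Fc A : range Bs A -> compact A.
  move=> [n _ <-]; have [[Bom clB _] _] := gB n.
  exact: subclosed_compact omega_compact Bom.
have Fdir A B : range Bs A -> range Bs B -> exists2 C, range Bs C & C `<=` A `&` B.
  move=> [n _ <-] [m _ <-]; exists (Bs (maxn n m)); first by exists (maxn n m).
  by move=> y By; split; apply: leB By; rewrite ?leq_maxl ?leq_maxr.
have [y yI] : \bigcap_(A in range Bs) A !=set0.
  apply: contrapT => /set0P/negP; rewrite negbK => /eqP I0.
  have [|A [n _ <-]] := filtered_bigcap_subset_open hT F0 Fc Fdir (@open0 T).
    by rewrite I0.
  by have [_ [z Bz]] := gB n => /(_ _ Bz).
have oy : om y by apply: (yI om); exists 0%N.
have [n [n0 fy]] := tp oy; case: n n0 fy => // n _ fy.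
have [_ _ h] := nxP (Bs n, n) (gB n); apply: (h y) fy.
by apply: (yI (Bs n.+1)); exists n.+1.
Qed.

Lemma omega_finite : finite_set om.
Proof.
apply: contrapT => inf.
have om0 : om !=set0.
  by apply: contrapT => /set0P/negP; rewrite negbK => /eqP o0; apply: inf; rewrite o0.
have [B [n [cB [y By] n0 fB]]] := clopen_fixed_power om0.
have oy : om y by case: cB => + _ _; exact.
have [z oz nz] : exists2 z, om z & ~ range (fun j => iter j f y) z.
  apply: contrapT => H; apply: inf.
  apply: sub_finite_set (periodic_orbit_finite (tp oy)) => z oz.
  by apply: contrapT => nz; apply: H; exists z.
pose Q := range (fun j => iter j f z).
(* If [y] were [iter i f z] with [z] of period [p], then [p * i - i] further steps would lead from
   [y] back to [z]. *)
have yQ : (~` Q) y.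
  move=> [i _ fi]; apply: nz; have [p [p0 fp]] := tp oz.
  exists (p * i - i)%N => //; rewrite -fi -iterD subnK; last by rewrite leq_pmull.
  by elim: i {fi} => [|i IH]; [rewrite muln0|rewrite mulnS iterD IH].
have oQ : open (~` Q) by apply: closed_openC; exact: finite_set_closed (periodic_orbit_finite (tp oz)).
have [B' [[B'om clB' clB''] B'y B'B]] := clopen_in_shrink cB By oQ yQ.
(* The points that visit [B'] within times [0] to [n - 1]. This set contains [y], but not [z], whose
   orbit misses [B']. *)
pose V := om `&` \bigcup_(i in `I_n) iter i f @^-1` B'.
suff VE : V = om.
  have : V z by rewrite VE.
  by move=> [_ [i _ /B'B[_]]]; apply; exists i.
have clpre i (A : set T) : closed A -> closed (iter i f @^-1` A).
  by move=> cA; apply: closed_comp => // ? _; exact: iter_continuous.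
apply: omega_incompressible.
- split; first by move=> ? [].
    apply: closedI omega_closed _; apply: closed_bigcup => [|i _]; last exact: clpre.
    exact: finite_II.
  have -> : om `\` V = om `&` \bigcap_(i in `I_n) iter i f @^-1` (om `\` B').
    apply/seteqP; split=> w.
      move=> [ow Vw]; split=> // i ni; split; first exact: omega_iter_invariant.
      by move=> Bw; apply: Vw; split=> //; exists i.
    by move=> [ow H]; split=> // -[_ [i ni Bw]]; have [_] := H i ni; exact.
  by apply: closedI omega_closed _; apply: closed_bigI => i _; exact: clpre.
- by exists y; split=> //; exists 0%N.
- move=> w [ow [i ni Bw]]; split; first exact: omega_invariant.
  case: i ni Bw => [|i] ni Bw; last first.
    by exists i; [exact: ltnW ni|rewrite /preimage /= -iterSr].
  (* A point [w] of [B'] is fixed by [iter n f], so [f w] returns to [B'] after [n - 1] steps. *)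
  exists n.-1; first by rewrite /= prednK.
  rewrite /preimage /= -iterSr prednK// fB//.
  by have [] := B'B _ Bw.
Qed.

End OmegaLimits.

Theorem theorem1p3 (R : realType) (T : pseudoMetricType R) :
  @is_continuum R T -> @hereditarily_locally_connected R T ->
  (@omega_FTP R T <-> @completely_regular_continuum R T).
Proof.
move=> [hT TC] hlc; have cT : compact [set: T] by case: TC => _ [].
split=> [ftp A cA ndA|cr f cf x tp].
  apply: contrapT => /set0P/negP; rewrite negbK => /eqP A0.
  have [f [x [cf tp]]] := nowhere_dense_subcontinuum_not_FTP hT TC hlc cA ndA A0.
  by apply; exact: ftp.
have [i0|ni0] := pselect ((omega_limit f x)° !=set0).
  exact: omega_interior_finite.
apply: omega_finite => // C cC Com p Cp q Cq; apply: contrapT => qp.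
(* A nondegenerate subcontinuum of the limit set would give it interior. *)
apply: ni0; have [|z Cz] := cr C cC; first by exists q, p.
by exists z; apply: filterS Cz.
Qed.
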